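(* Let $GC(G,S,\alpha)$ be a generalized Cayley graph and let $K=\{\alpha(g)\mid g\in G,\ gS=S\}=\{g\in G\mid \alpha(g)S=S\}$. Then $GC(G,S,\alpha)$ is unworthy if and only if $K\neq\{1_G\}$.
   Context: Let $G$ be a group, $S\subseteq G$ and $\alpha\in\mathrm{Aut}(G)$ such that: (i) $\alpha^2=1$; (ii) $\alpha(x^{-1})x\notin S$ for every $x\in G$; (iii) for all $x,y\in G$, if $\alpha(x^{-1})y\in S$ then $\alpha(y^{-1})x\in S$ (given (i), this is equivalent to $\alpha(S^{-1})=S$). The generalized Cayley graph $GC(G,S,\alpha)$ is the (simple, undirected) graph with vertex set $G$ in which $x,y$ are adjacent iff $\alpha(x^{-1})y\in S$. A graph is unworthy if it has two distinct vertices with the same set of neighbours. For $g\in G$, $gS=\{gs\mid s\in S\}$. $K$ is a subgroup of $G$. *)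

(* Defs.v *)
From mathcomp Require Import all_boot.
From mathcomp Require Import boolp classical_sets.
Set Implicit Arguments.
Unset Strict Implicit.
Unset Printing Implicit Defensive.
Local Open Scope classical_set_scope.
Local Open Scope group_scope.

(* Simple undirected graphs, possibly infinite: [adj] is Prop-valued because the
   connection set of a generalized Cayley graph need not be decidable. *)
Record sgraph := SGraph {
  vertex :> Type;
  adj : vertex -> vertex -> Prop;
  adj_sym : forall x y, adj x y -> adj y x;
  adj_irrefl : forall x, ~ adj x x
}.

Definition neighbours (X : sgraph) (x : X) : set X := [set y | adj x y].

Definition unworthy (X : sgraph) : Prop :=
  exists x y : X, x <> y /\ neighbours x = neighbours y.

Record gc_conditions (G : groupType) (S : set G)
    (alpha : {multiplicative G -> G}) : Prop := GCConditions {
  gc_bij : bijective alpha;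
  gc_invol : forall x, alpha (alpha x) = x;
  gc_loopless : forall x, ~ S (alpha x^-1 * x);
  gc_sym : forall x y, S (alpha x^-1 * y) -> S (alpha y^-1 * x)
}.

Definition GC (G : groupType) (S : set G) (alpha : {multiplicative G -> G})
    (gcS : gc_conditions S alpha) : sgraph :=
  @SGraph G (fun x y => S (alpha x^-1 * y)) (gc_sym gcS) (gc_loopless gcS).

Definition ltranslate (G : groupType) (g : G) (S : set G) : set G :=
  [set g * s | s in S].

Definition gcK (G : groupType) (S : set G) (alpha : {multiplicative G -> G}) :
    set G :=
  [set alpha g | g in [set g | ltranslate g S = S]].

(* Main.v *)
Require Import Defs.
From mathcomp Require Import all_boot.
From mathcomp Require Import boolp classical_sets.
Local Open Scope classical_set_scope.
Local Open Scope group_scope.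

(* The neighbourhood of [x] is the left translate [alpha x S], so distinct
   [x, y] are twins exactly when [y^-1 x <> 1] is a witness in [K]. *)

(** Left translation is an action of [G] on subsets, so by [neighbours_GC] equal neighbourhoods of
    [x] and [y] can be cancelled to put [y^-1 * x] in the set of [g] with [alpha g] stabilizing [S].
    Conversely, any [g] in that set is a twin of [1] when [g <> 1]. By [gcKE] this set is [K]. *)

(* [{multiplicative G -> H}] only packages the product law, so [gmulf1] and
   [gmulfV] do not apply to it. *)
Lemma multiplicative1 (G H : groupType) (f : {multiplicative G -> H}) : f 1 = 1.
Proof. by apply: (mulgI (f 1)); rewrite -gmulfM !mulg1. Qed.

Lemma multiplicativeV (G H : groupType) (f : {multiplicative G -> H}) x :
  f x^-1 = (f x)^-1.
Proof.
by apply: (mulgI (f x)); rewrite -gmulfM !mulgV multiplicative1.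
Qed.

Lemma ltranslate1 (G : groupType) (S : set G) : ltranslate 1 S = S.
Proof.
apply/seteqP; split=> [_ [s Ss <-]|s Ss]; first by rewrite mul1g.
by exists s; rewrite ?mul1g.
Qed.

Lemma ltranslateM (G : groupType) (g h : G) (S : set G) :
  ltranslate (g * h) S = ltranslate g (ltranslate h S).
Proof.
apply/seteqP; split=> [_ [s Ss <-]|_ [_ [s Ss <-] <-]].
  by exists (h * s); [exists s | rewrite mulgA].
by exists s; rewrite ?mulgA.
Qed.

Lemma ltranslate_preimage (G : groupType) (g : G) (S : set G) :
  ltranslate g S = [set x | S (g^-1 * x)].
Proof.
apply/seteqP; split=> [_ [s Ss <-]|x Sx] /=; first by rewrite mulKg.
by exists (g^-1 * x); rewrite ?mulVKg.
Qed.

(** Since [alpha] commutes with inversion, adjacency says exactly that [(alpha x)^-1 * y] lies in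
    [S]. *)
Lemma neighbours_GC (G : groupType) (S : set G)
    (alpha : {multiplicative G -> G}) (gcS : gc_conditions S alpha)
    (x : GC gcS) : neighbours x = ltranslate (alpha x) S.
Proof. by rewrite ltranslate_preimage -multiplicativeV. Qed.

(** An involution is its own inverse, so image and preimage under it coincide. *)
Lemma gcKE (G : groupType) (S : set G) (alpha : {multiplicative G -> G}) :
  involutive alpha -> gcK S alpha = [set g | ltranslate (alpha g) S = S].
Proof.
move=> alphaK; apply/seteqP; split=> [_ [g gS <-]|g gS] /=.
  by rewrite alphaK.
by exists (alpha g).
Qed.

Theorem corollary5p2 (G : groupType) (S : set G)
    (alpha : {multiplicative G -> G}) (gcS : gc_conditions S alpha) :
  gcK S alpha = [set g | ltranslate (alpha g) S = S] /\
  (unworthy (GC gcS) <-> gcK S alpha <> [set 1]).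
Proof.
have KE := @gcKE G S alpha (gc_invol gcS); split=> //; rewrite KE; split.
  move=> [x [y [xy]]]; rewrite !neighbours_GC => Nxy K1.
  (* Apply [alpha y^-1] to both sides of [Nxy]. *)
  have : [set g | ltranslate (alpha g) S = S] (y^-1 * x).
    by rewrite /= gmulfM ltranslateM Nxy -ltranslateM -gmulfM mulVg multiplicative1
               ltranslate1.
  by rewrite K1 => /= yx1; apply: xy; rewrite -[x](mulVKg y) yx1 mulg1.
(* Without twins, [K] is trivial: it always contains [1], and any other element would give a twin
   pair. *)
move=> K1; apply: contrapT => worthy; apply: K1.
apply/seteqP; split=> [g /= gS|_ ->] /=; last by rewrite multiplicative1 ltranslate1.
(* Both [g] and [1] have neighbourhood [S]. *)
apply: contrapT => g1; apply: worthy; exists g, 1; split=> //.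
by rewrite !neighbours_GC gS multiplicative1 ltranslate1.
Qed.
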